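(* Let $A$ be an integral $k$-algebra of finite type over an algebraically closed field $k$ of characteristic $p>0$. Let $\deg$ be a good degree function on $K(A)$. Let $\mathcal{F}$ be a foliation on $Spec(A)$, spanned (as an $A$-module) by $D_1,\dots,D_n$. Then $$\dim_{\mathbb{F}_p}\Pi(A,\mathcal{F})\leq l(\deg(D_1))+\dots+l(\deg(D_n)).$$
   Context: ''Integral'' means that the (commutative) ring $A$ is an integral domain; $K(A)$ denotes its fraction field. $Der_k(A)$ is the set of $k$-derivations $A\to A$; each such derivation extends uniquely to $K(A)$. Foliation: a foliation on $Spec(A)$ is an $A$-submodule $\mathcal{F}$ of $Der_k(A)$ such that $[D,D']=D\circ D'-D'\circ D\in\mathcal{F}$ for all $D,D'\in\mathcal{F}$, and $D^p=D\circ\dots\circ D$ ($p$ times) belongs to $\mathcal{F}$ for all $D\in\mathcal{F}$. $\Pi(A,\mathcal{D})$: for $\mathcal{D}\subseteq Der_k(A)$, an element $f\in K(A)^*$ is an algebraic solution of $\mathcal{D}$ if $D(f)/f\in A$ for every $D\in\mathcal{D}$, and a first integral of $\mathcal{D}$ if $D(f)=0$ for every $D\in\mathcal{D}$. Both sets are multiplicative subgroups of $K(A)^*$, and $\Pi(A,\mathcal{D})=\{\text{algebraic solutions of }\mathcal{D}\}/\{\text{first integrals of }\mathcal{D}\}$, which is an $\mathbb{F}_p$-vector space because $D(f^p)=0$ for all $f\in K(A)$. Degrees: a degree function on $K(A)$ is a map $\deg:K(A)\to\mathbb{Z}\cup\{-\infty\}$ with $\deg(f)=-\infty$ iff $f=0$,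 $\deg(fg)=\deg(f)+\deg(g)$ and $\deg(f+g)\leq\max(\deg(f),\deg(g))$. For a $k$-derivation $D$ on $A$, $\deg(D)=\sup\{\deg(D(f))-\deg(f)\}$, the supremum being over nonzero $f\in K(A)$; ''finite'' means $<+\infty$ (so $\deg(0)=-\infty$ for the zero derivation). A degree function $\deg$ on $K(A)$ with $\deg(a)=0$ for all $a\in k^*$ is good if (i) for every $k$-derivation $D$ on $A$, $\deg(D)$ is finite, and (ii) for every integer $n$, the dimension $l(n)$ over $k$ of $\{f\in A\mid \deg(f)\leq n\}$ is finite. By convention $l(-\infty)=0$. *)

(* Defs.v *)
From HB Require Import structures.
From mathcomp Require Import all_boot all_order all_algebra.
From mathcomp Require Import generic_quotient fraction.
From mathcomp Require Import boolp classical_sets constructive_ereal.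
From mathcomp Require Import ring.
From mathcomp Require mpoly.

Set Implicit Arguments.
Unset Strict Implicit.
Unset Printing Implicit Defensive.

Import Order.TTheory GRing.Theory Num.Theory.
Local Open Scope ring_scope.
Local Open Scope classical_set_scope.

Notation "x %:F" := (@FracField.tofrac _ x) : ring_scope.

(* Commutative k-algebras that are integral domains; the unit predicate and the
   inverse carried by the structure are no additional data classically. *)
#[short(type="idomAlgType")]
HB.structure Definition IdomAlgebra (k : fieldType) :=
  {A of GRing.ComUnitAlgebra k A & GRing.IntegralDomain A}.

Definition finite_type (k : fieldType) (A : idomAlgType k) : Prop :=
  exists (m : nat) (g : 'I_m -> A), forall x : A,
    exists P : mpoly.mpoly m k, x = mpoly.mmap (GRing.in_alg A) g P.

Section Dimension.
Variables (K : fieldType) (V : lmodType K).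
Implicit Types (U : set V) (d : nat).

Definition is_basis U d (b : 'I_d -> V) : Prop :=
  (forall c : 'I_d -> K, \sum_(i < d) c i *: b i = 0 -> forall i, c i = 0) /\
  U = [set \sum_(i < d) c i *: b i | c in [set: 'I_d -> K]].

Definition has_dim U d : Prop := exists b : 'I_d -> V, is_basis U b.

Definition findim U : Prop := exists d, has_dim U d.

(* 0 if U is not a finite-dimensional subspace *)
Definition dimension U : nat := xget 0%N [set d | has_dim U d].

End Dimension.

Definition leibniz (R : pzRingType) (D : R -> R) : Prop :=
  forall f g, D (f * g) = D f * g + f * D g.

Section LeibnizField.
Variables (F : fieldType) (D : F -> F) (DM : leibniz D).
Implicit Types f g : F.

Lemma leibniz1 : D 1 = 0.
Proof.
by apply: (addrI (D 1)); rewrite -{3}(mulr1 1) DM mulr1 mul1r addr0.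
Qed.

Lemma leibnizV f : f != 0 -> D f^-1 = - D f / f ^+ 2.
Proof.
move=> f0; apply: (mulfI f0); apply: (addrI (D f * f^-1)).
by rewrite -DM divff // leibniz1; field; rewrite f0.
Qed.

Lemma leibnizX f n : D (f ^+ n) = f ^+ n.-1 * D f *+ n.
Proof.
elim: n => [|[|n] IHn]; first by rewrite leibniz1 mulr0n.
  by rewrite expr0 mul1r mulr1n expr1.
rewrite exprS DM IHn /= mulrnAr mulrA -exprS [RHS]mulrS.
by rewrite [D f * _]mulrC.
Qed.

Lemma leibniz_logM f g : f != 0 -> g != 0 ->
  D (f * g) / (f * g) = D f / f + D g / g.
Proof. by move=> f0 g0; rewrite DM; field; rewrite f0 g0. Qed.

Lemma leibniz_logV f : f != 0 -> D f^-1 / f^-1 = - (D f / f).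
Proof. by move=> f0; rewrite leibnizV // invrK; field; rewrite f0. Qed.

Lemma leibniz_div f g : g != 0 -> D (f / g) = (D f * g - f * D g) / g ^+ 2.
Proof. by move=> g0; rewrite DM leibnizV //; field; rewrite g0. Qed.

End LeibnizField.

Section QuotientRule.
Variables (F : fieldType) (a b c d a' b' c' d' : F).
Hypotheses (b0 : b != 0) (d0 : d != 0).

Lemma quotient_rule_eq : c * b = a * d ->
  c' * b + c * b' = a' * d + a * d' ->
  (c' * d - c * d') / d ^+ 2 = (a' * b - a * b') / b ^+ 2.
Proof.
move=> e e'; have -> : c = a * d / b by rewrite -e mulfK.
have -> : c' = (a' * d + a * d' - a * d / b * b') / b.
  by rewrite -e' -e mulfK // addrK mulfK.
by field; rewrite b0 d0.
Qed.

Lemma quotient_ruleD :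
  ((a' * d + a * d' + (c' * b + c * b')) * (b * d)
     - (a * d + c * b) * (b' * d + b * d')) / (b * d) ^+ 2 =
  (a' * b - a * b') / b ^+ 2 + (c' * d - c * d') / d ^+ 2.
Proof. by field; rewrite b0 d0. Qed.

Lemma quotient_ruleM :
  ((a' * c + a * c') * (b * d) - a * c * (b' * d + b * d')) / (b * d) ^+ 2 =
  (a' * b - a * b') / b ^+ 2 * (c / d) + a / b * ((c' * d - c * d') / d ^+ 2).
Proof. by field; rewrite b0 d0. Qed.

End QuotientRule.

Section Derivations.
Variables (k : fieldType) (A : idomAlgType k).

Record derivation := Derivation {
  der_fun :> A -> A;
  der_is_linear : linear der_fun;
  derM : leibniz der_fun }.

HB.instance Definition _ (D : derivation) :=
  GRing.isLinear.Build k A A *:%R (der_fun D) (@der_is_linear D).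

Lemma derD (D : derivation) : {morph D : f g / f + g}.
Proof. exact: linearD. Qed.

HB.instance Definition _ := gen_eqMixin derivation.
HB.instance Definition _ := gen_choiceMixin derivation.

Lemma derivationP (D E : derivation) : D =1 E -> D = E.
Proof.
case: D E => [D Dl DM] [E El EM] /= /funext DE.
by rewrite {}DE in Dl DM *; congr Derivation; exact: Prop_irrelevance.
Qed.

Fact der0_linear : linear (fun _ : A => 0 : A).
Proof. by move=> a f g; rewrite scaler0 addr0. Qed.
Fact der0_leibniz : leibniz (fun _ : A => 0).
Proof. by move=> f g; rewrite mul0r mulr0 addr0. Qed.
Definition der0 := Derivation der0_linear der0_leibniz.

Fact deropp_linear (D : derivation) : linear (fun f => - D f).
Proof. by move=> a f g; rewrite linearP opprD scalerN. Qed.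
Fact deropp_leibniz (D : derivation) : leibniz (fun f => - D f).
Proof. by move=> f g; rewrite derM opprD mulNr mulrN. Qed.
Definition deropp D := Derivation (deropp_linear D) (@deropp_leibniz D).

Fact deradd_linear (D E : derivation) : linear (fun f => D f + E f).
Proof. by move=> a f g; rewrite !linearP scalerDr addrACA. Qed.
Fact deradd_leibniz (D E : derivation) : leibniz (fun f => D f + E f).
Proof. by move=> f g; rewrite !derM mulrDl mulrDr addrACA. Qed.
Definition deradd D E :=
  Derivation (deradd_linear D E) (@deradd_leibniz D E).

Fact derscale_linear (a : A) (D : derivation) : linear (fun f => a * D f).
Proof. by move=> c f g; rewrite linearP mulrDr scalerAr. Qed.
Fact derscale_leibniz (a : A) (D : derivation) : leibniz (fun f => a * D f).
Proof. by move=> f g; rewrite derM mulrDr mulrA [f * (_ * _)]mulrCA. Qed.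
Definition derscale a D :=
  Derivation (derscale_linear a D) (@derscale_leibniz a D).

Fact deraddA : associative deradd.
Proof. by move=> D E F; apply: derivationP => f /=; rewrite addrA. Qed.
Fact deraddC : commutative deradd.
Proof. by move=> D E; apply: derivationP => f /=; rewrite addrC. Qed.
Fact der0D : left_id der0 deradd.
Proof. by move=> D; apply: derivationP => f /=; rewrite add0r. Qed.
Fact deraddN : left_inverse der0 deropp deradd.
Proof. by move=> D; apply: derivationP => f /=; rewrite addNr. Qed.

HB.instance Definition _ :=
  GRing.isZmodule.Build derivation deraddA deraddC der0D deraddN.

Fact derscaleA a b D : derscale a (derscale b D) = derscale (a * b) D.
Proof. by apply: derivationP => f /=; rewrite mulrA. Qed.
Fact derscale1 : left_id 1 derscale.
Proof. by move=> D; apply: derivationP => f /=; rewrite mul1r. Qed.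
Fact derscaleDr : right_distributive derscale +%R.
Proof. by move=> a D E; apply: derivationP => f /=; rewrite mulrDr. Qed.
Fact derscaleDl D : {morph derscale^~ D : a b / a + b}.
Proof. by move=> a b; apply: derivationP => f /=; rewrite mulrDl. Qed.

HB.instance Definition _ := GRing.Zmodule_isLmodule.Build A derivation
  derscaleA derscale1 derscaleDr derscaleDl.

Fact bracket_linear (D E : derivation) : linear (fun f => D (E f) - E (D f)).
Proof.
by move=> a f g; rewrite !(linearP D, linearP E) scalerBr opprD addrACA.
Qed.

Fact bracket_leibniz (D E : derivation) :
  leibniz (fun f => D (E f) - E (D f)).
Proof.
by move=> f g; rewrite !(derM, linearD) /= !derM; ring.
Qed.

Definition bracket D E :=
  Derivation (bracket_linear D E) (@bracket_leibniz D E).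

Lemma iter_der_leibniz (D : derivation) n f g :
  iter n D (f * g) =
    \sum_(i < n.+1) (iter (n - i) D f * iter i D g) *+ 'C(n, i).
Proof.
elim: n => [|n IHn] /=; first by rewrite big_ord1.
rewrite IHn raddf_sum /=.
under eq_bigr => i _ do
  rewrite raddfMn /= derM -iterS -[D (iter i D g)]iterS -subSn 1?leq_ord // mulrnDl.
rewrite big_split /= [RHS]big_ord_recl /= bin0 mulr1n.
under [X in _ = _ + X]eq_bigr => i _ do rewrite binS mulrnDr subSS.
rewrite big_split /= addrA; congr (_ + _).
rewrite big_ord_recl /= bin0 mulr1n; congr (_ + _).
rewrite [RHS]big_ord_recr /= bin_small // mulr0n addr0.
by apply: eq_bigr => i _; rewrite subSS.
Qed.

End Derivations.

Section FrobeniusPower.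
Variables (k : fieldType) (p : nat) (hp : p \in [pchar k]).
Variable A : idomAlgType k.

Fact derpow_linear (D : derivation A) : linear (iter p D).
Proof.
move=> a f g; elim: p => //= n ->; by rewrite linearP.
Qed.

Lemma pchar_idomAlg : p \in [pchar A].
Proof. by rewrite pchar_lalg. Qed.

Fact derpow_leibniz (D : derivation A) : leibniz (iter p D).
Proof.
have := pcharf_prime hp; have := pchar_idomAlg; case: (p) => // q hq pq f g.
rewrite iter_der_leibniz big_ord_recl big_ord_recr /= bin0 binn subnn.
rewrite !mulr1n big1 ?add0r // => i _.
rewrite -mulr_natl (_ : _%:R = 0 :> A) ?mul0r //; apply/eqP.
by rewrite -(dvdn_pcharf hq) prime_dvd_bin // !ltnS ltn_ord.
Qed.

Definition derpow D := Derivation (derpow_linear D) (@derpow_leibniz D).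

Record foliation (F : set (derivation A)) : Prop := {
  foliation0 : F 0;
  foliationP : forall (a : A) D E, F D -> F E -> F (a *: D + E);
  foliation_bracket : forall D E, F D -> F E -> F (bracket D E);
  foliation_pow : forall D, F D -> F (derpow D) }.

End FrobeniusPower.

Section FractionField.
Variables (k : fieldType) (A : idomAlgType k).
Local Notation K := {fraction A}.

(* The extension of D to K(A), given by the quotient rule on the chosen
   representative; der_frac_tofrac, der_fracD, der_fracM and der_frac_unique
   characterise it. *)
Definition der_frac (D : derivation A) (f : K) : K :=
  let n := \n_(repr f) in let d := \d_(repr f) in
  ((D n)%:F * d%:F - n%:F * (D d)%:F) / d%:F ^+ 2.

Lemma frac_repr (f : K) : f = (\n_(repr f))%:F / (\d_(repr f))%:F.
Proof.
have d0 : (\d_(repr f))%:F != 0 :> K by rewrite tofrac_eq0 denom_ratioP.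
apply: (canRL (mulfK d0)); rewrite -[X in X * _]reprK.
move: (repr f) => x {d0}; rewrite !piE; apply/eqmodP => /=.
rewrite FracField.equivfE /FracField.mulf !numden_Ratio ?mulf_neq0 ?oner_eq0 ?denom_ratioP //.
by rewrite mulr1 mulrC mulr1.
Qed.

Lemma der_fracE D (a b : A) : b != 0 ->
  der_frac D (a%:F / b%:F) =
  ((D a)%:F * b%:F - a%:F * (D b)%:F) / b%:F ^+ 2.
Proof.
move=> b0; rewrite /der_frac; set r := repr _.
have d0 : \d_r != 0 := denom_ratioP r.
have bF0 : b%:F != 0 :> K by rewrite tofrac_eq0.
have dF0 : (\d_r)%:F != 0 :> K by rewrite tofrac_eq0.
have e : a%:F / b%:F = (\n_r)%:F / (\d_r)%:F :> K by rewrite -frac_repr.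
have {}e : \n_r * b = a * \d_r.
  apply/eqP; rewrite -tofrac_eq !tofracM.
  by rewrite -(eqr_div _ _ dF0 bF0) e.
apply: (quotient_rule_eq bF0 dF0); rewrite -!tofracM ?e -?tofracD.
  by [].
by rewrite -!derM e.
Qed.

Lemma der_frac_tofrac D (a : A) : der_frac D a%:F = (D a)%:F.
Proof.
have D1 : D 1 = 0.
  by apply: (addrI (D 1)); rewrite -{3}(mulr1 1) derM mulr1 mul1r addr0.
rewrite -[in LHS](divr1 a%:F) -tofrac1 der_fracE ?oner_eq0 //.
by rewrite D1 rmorph0 mulr0 subr0 tofrac1 expr1n divr1 mulr1.
Qed.

Lemma fracP (f : K) : exists2 ab : A * A, ab.2 != 0 & f = ab.1%:F / ab.2%:F.
Proof. by exists (frac (repr f)); [exact: denom_ratioP | exact: frac_repr]. Qed.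

Lemma der_fracD D : {morph der_frac D : f g / f + g}.
Proof.
move=> f g.
have [[a b] /= b0 ->] := fracP f; have [[c d] /= d0 ->] := fracP g.
have bF : b%:F != 0 :> K by rewrite tofrac_eq0.
have dF : d%:F != 0 :> K by rewrite tofrac_eq0.
rewrite (addf_div _ _ bF dF) -3!tofracM -tofracD !der_fracE ?mulf_neq0 ?b0 ?d0 //.
rewrite derD !derM !tofracD !tofracM; exact: (quotient_ruleD _ _ _ _ _ _ bF dF).
Qed.

Lemma der_fracM D : leibniz (der_frac D).
Proof.
move=> f g.
have [[a b] /= b0 ->] := fracP f; have [[c d] /= d0 ->] := fracP g.
have bF : b%:F != 0 :> K by rewrite tofrac_eq0.
have dF : d%:F != 0 :> K by rewrite tofrac_eq0.
rewrite mulf_div -2!tofracM !der_fracE ?mulf_neq0 //.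
by rewrite !derM !tofracD !tofracM; exact: (quotient_ruleM _ _ _ _ _ _ bF dF).
Qed.

Lemma der_frac_unique (D : derivation A) (E : K -> K) :
  leibniz E -> (forall a, E a%:F = (D a)%:F) -> E =1 der_frac D.
Proof.
move=> EM ED f; have [[a b] /= b0 ->] := fracP f.
have bF : b%:F != 0 :> K by rewrite tofrac_eq0.
by rewrite der_fracE // -!ED; exact: leibniz_div.
Qed.

Implicit Types (DD : set (derivation A)) (f g : K).

Definition algebraic_solution DD : set K :=
  [set f | f != 0 /\
     forall D, DD D -> exists a : A, der_frac D f / f = a%:F].

Definition first_integral DD : set K :=
  [set f | f != 0 /\ forall D, DD D -> der_frac D f = 0].

Lemma algebraic_solution1 DD : algebraic_solution DD 1.
Proof.
split=> [|D _]; first exact: oner_neq0.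
by exists 0; rewrite (leibniz1 (der_fracM D)) mul0r rmorph0.
Qed.

Lemma algebraic_solutionM DD f g : algebraic_solution DD f ->
  algebraic_solution DD g -> algebraic_solution DD (f * g).
Proof.
move=> [f0 Hf] [g0 Hg]; split=> [|D DDD]; first by rewrite mulf_neq0.
have [[a ea] [b eb]] := (Hf D DDD, Hg D DDD).
exists (a + b); rewrite rmorphD /= -ea -eb.
exact: leibniz_logM (der_fracM D) _ _ f0 g0.
Qed.

Lemma algebraic_solutionV DD f :
  algebraic_solution DD f -> algebraic_solution DD f^-1.
Proof.
move=> [f0 Hf]; split=> [|D DDD]; first by rewrite invr_eq0.
have [a ea] := Hf D DDD; exists (- a).
rewrite rmorphN /= -ea; exact: leibniz_logV (der_fracM D) _ f0.
Qed.

Lemma first_integral1 DD : first_integral DD 1.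
Proof. by split=> [|D _]; [exact: oner_neq0 | exact: leibniz1 (der_fracM D)]. Qed.

Lemma first_integralM DD f g :
  first_integral DD f -> first_integral DD g -> first_integral DD (f * g).
Proof.
move=> [f0 Hf] [g0 Hg]; split=> [|D DDD]; first by rewrite mulf_neq0.
by rewrite der_fracM Hf // Hg // mul0r mulr0 addr0.
Qed.

Lemma first_integralV DD f : first_integral DD f -> first_integral DD f^-1.
Proof.
move=> [f0 Hf]; split=> [|D DDD]; first by rewrite invr_eq0.
by rewrite (leibnizV (der_fracM D)) // Hf // oppr0 mul0r.
Qed.

Lemma first_integral_algebraic DD f :
  first_integral DD f -> algebraic_solution DD f.
Proof.
move=> [f0 Hf]; split=> // D DDD.
by exists 0; rewrite Hf // mul0r rmorph0.
Qed.

Lemma first_integral_pchar p DD f : p \in [pchar k] -> f != 0 ->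
  first_integral DD (f ^+ p).
Proof.
move=> hp f0; split=> [|D _]; first by rewrite expf_neq0.
have hpK : p \in [pchar K] by rewrite (rmorph_pchar (@FracField.tofrac A)) // pchar_lalg.
by rewrite (leibnizX (der_fracM D)) -mulr_natl (pcharf0 hpK) mul0r.
Qed.

End FractionField.

Section Pi.
Variables (k : fieldType) (A : idomAlgType k) (DD : set (derivation A)).
Local Notation K := {fraction A}.
Local Open Scope quotient_scope.

Record solution := Solution {
  solution_val :> K;
  solutionP : `[< algebraic_solution DD solution_val >] }.
HB.instance Definition _ := [isSub for solution_val].
HB.instance Definition _ := [Choice of solution by <:].

Definition solution_eqv (f g : solution) : bool :=
  `[< first_integral DD ((f : K) / (g : K)) >].

Lemma solution_neq0 (f : solution) : (f : K) != 0.
Proof. by case: f => f /= /asboolP[]. Qed.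

Fact solution_eqv_refl : reflexive solution_eqv.
Proof.
by move=> f; apply/asboolP; rewrite divff ?solution_neq0 //; exact: first_integral1.
Qed.

Fact solution_eqv_sym : symmetric solution_eqv.
Proof.
by move=> f g; apply/asboolP/asboolP => /first_integralV; rewrite invf_div.
Qed.

Fact solution_eqv_trans : transitive solution_eqv.
Proof.
move=> g f h /asboolP fg /asboolP gh; apply/asboolP.
by have := first_integralM fg gh; rewrite mulrA divfK ?solution_neq0.
Qed.

Canonical solution_equiv := EquivRel solution_eqv
  solution_eqv_refl solution_eqv_sym solution_eqv_trans.

(* The characteristic is an argument so that the F_p-vector space structure
   below can be attached to the type. *)
Definition Pi p of p \in [pchar k] : Type := {eq_quot solution_eqv}.

End Pi.

Section PiTheory.
Variables (k : fieldType) (p : nat) (hp : p \in [pchar k]).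
Variables (A : idomAlgType k) (DD : set (derivation A)).
Local Notation K := {fraction A}.
Local Notation Pi := (Pi DD hp).
Local Open Scope quotient_scope.

HB.instance Definition _ := EqQuotient.copy Pi {eq_quot solution_eqv (DD := DD)}.
HB.instance Definition _ := Choice.copy Pi {eq_quot solution_eqv (DD := DD)}.

Definition sol1 : solution DD :=
  Solution (introT (asboolP _) (algebraic_solution1 DD)).
Definition solM (f g : solution DD) : solution DD :=
  Solution (introT (asboolP _) (algebraic_solutionM
    (elimT (asboolP _) (solutionP f)) (elimT (asboolP _) (solutionP g)))).
Definition solV (f : solution DD) : solution DD :=
  Solution (introT (asboolP _) (algebraic_solutionV
    (elimT (asboolP _) (solutionP f)))).

(* The group law of Pi is written additively. *)
Definition Pi0 : Pi := \pi_Pi sol1.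
Definition Pi_add (x y : Pi) : Pi := \pi_Pi (solM (repr x) (repr y)).
Definition Pi_opp (x : Pi) : Pi := \pi_Pi (solV (repr x)).

Lemma Pi_eqP (f g : solution DD) :
  reflect (first_integral DD ((f : K) / (g : K))) (\pi_Pi f == \pi_Pi g).
Proof. by rewrite eqmodE; exact: asboolP. Qed.

Lemma pi_solM f g : \pi_Pi (solM f g) = Pi_add (\pi_Pi f) (\pi_Pi g).
Proof.
apply/eqP/Pi_eqP => /=.
have /eqP/Pi_eqP ef : \pi_Pi f = \pi_Pi (repr (\pi_Pi f)) by rewrite reprK.
have /eqP/Pi_eqP eg : \pi_Pi g = \pi_Pi (repr (\pi_Pi g)) by rewrite reprK.
by have := first_integralM ef eg; rewrite mulf_div.
Qed.

Lemma pi_solV f : \pi_Pi (solV f) = Pi_opp (\pi_Pi f).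
Proof.
apply/eqP/Pi_eqP => /=.
have /eqP/Pi_eqP ef : \pi_Pi f = \pi_Pi (repr (\pi_Pi f)) by rewrite reprK.
by have := first_integralV ef; rewrite invfM.
Qed.

Fact Pi_addA : associative Pi_add.
Proof.
elim/quotW=> f; elim/quotW=> g; elim/quotW=> h.
rewrite -(pi_solM g h) -(pi_solM f (solM g h)) -(pi_solM f g).
rewrite -(pi_solM (solM f g) h).
by congr (\pi_Pi _); apply: val_inj => /=; rewrite mulrA.
Qed.

Fact Pi_addC : commutative Pi_add.
Proof.
elim/quotW=> f; elim/quotW=> g; rewrite -(pi_solM f g) -(pi_solM g f).
by congr (\pi_Pi _); apply: val_inj => /=; rewrite mulrC.
Qed.

Fact Pi_add0 : left_id Pi0 Pi_add.
Proof.
elim/quotW=> f; rewrite /Pi0 -(pi_solM sol1 f).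
by congr (\pi_Pi _); apply: val_inj => /=; rewrite mul1r.
Qed.

Fact Pi_addN : left_inverse Pi0 Pi_opp Pi_add.
Proof.
elim/quotW=> f; rewrite -(pi_solV f) -(pi_solM (solV f) f).
congr (\pi_Pi _); apply: val_inj => /=.
by rewrite mulVf ?solution_neq0.
Qed.

HB.instance Definition _ :=
  GRing.isZmodule.Build Pi Pi_addA Pi_addC Pi_add0 Pi_addN.

Lemma pi_solMn (f : solution DD) n (g : solution DD) : (g : K) = (f : K) ^+ n ->
  \pi_Pi f *+ n = \pi_Pi g :> Pi.
Proof.
elim: n g => [|n IHn] g eg.
  by rewrite mulr0n; congr (\pi_Pi _); apply: val_inj; rewrite /= eg.
have Hg : algebraic_solution DD ((f : K)^+ n).
  elim: n {IHn eg} => [|n IHn]; first exact: algebraic_solution1.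
  by rewrite exprS; apply: algebraic_solutionM IHn; apply/asboolP/solutionP.
rewrite mulrS (IHn (Solution (introT (asboolP _) Hg))) // -[LHS]pi_solM.
by congr (\pi_Pi _); apply: val_inj; rewrite /= eg exprS.
Qed.

Lemma Pi_mulrp (x : Pi) : x *+ p = 0.
Proof.
have f0 := solution_neq0 (repr x).
have Hf := first_integral_pchar DD hp f0.
have Hg := first_integral_algebraic Hf.
rewrite -[x]reprK (@pi_solMn _ _ (Solution (introT (asboolP _) Hg))) //.
by apply/eqP/Pi_eqP; rewrite /= divr1.
Qed.

Lemma Pi_mulrn_mod (x : Pi) n : x *+ (n %% p) = x *+ n.
Proof. by rewrite [in RHS](divn_eq n p) mulrnDr mulnC mulrnA Pi_mulrp mul0rn add0r. Qed.

Definition Pi_scale (a : 'F_p) (x : Pi) : Pi := x *+ a.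

Lemma Pi_mulrn_Fp (x : Pi) n : x *+ (n %% (Zp_trunc (pdiv p)).+2) = x *+ n.
Proof. by rewrite (Fp_cast (pcharf_prime hp)) Pi_mulrn_mod. Qed.

Fact Pi_scaleA a b x : Pi_scale a (Pi_scale b x) = Pi_scale (a * b) x.
Proof. by rewrite /Pi_scale -mulrnA mulnC -[LHS]Pi_mulrn_Fp. Qed.
Fact Pi_scale1 : left_id 1 Pi_scale.
Proof. by []. Qed.
Fact Pi_scaleDr : right_distributive Pi_scale +%R.
Proof. by move=> a x y; rewrite /Pi_scale mulrnDl. Qed.
Fact Pi_scaleDl x : {morph Pi_scale^~ x : a b / a + b}.
Proof. by move=> a b; rewrite /Pi_scale -mulrnDr -[RHS]Pi_mulrn_Fp. Qed.

HB.instance Definition _ := GRing.Zmodule_isLmodule.Build 'F_p Pi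
  Pi_scaleA Pi_scale1 Pi_scaleDr Pi_scaleDl.

End PiTheory.

Section Degree.
Variables (k : fieldType) (A : idomAlgType k).
Local Notation K := {fraction A}.
Local Open Scope ereal_scope.

(* Values lie in Z together with -oo: the field degree_lty excludes +oo. *)
Record degree_function (F : fieldType) (deg : F -> \bar int) : Prop := {
  degree_lty : forall f, deg f < +oo;
  degree_eqNy : forall f, deg f = -oo <-> f = 0%R;
  degreeM : forall f g, deg (f * g)%R = deg f + deg g;
  degreeD : forall f g, deg (f + g)%R <= maxe (deg f) (deg g) }.

(* The supremum is taken in Z with both infinities, where every set has one. *)
Definition der_degree (deg : K -> \bar int) (D : derivation A) : \bar int :=
  supremum -oo [set deg (der_frac D f) - deg f | f in [set f : K | f != 0%R]].

Definition degree_le (deg : K -> \bar int) (n : int) : set A :=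
  [set f | deg f%:F%R <= n%:E].

Record good_degree (deg : K -> \bar int) : Prop := {
  good_degree_function : degree_function deg;
  good_degree_const : forall a : k, a != 0%R -> deg (a%:A)%:F%R = 0;
  good_der_degree : forall D : derivation A, der_degree deg D < +oo;
  good_findim : forall n : int, findim (degree_le deg n) }.

(* The value at +oo is a placeholder: derivations have finite degree when deg
   is good. *)
Definition ldim (deg : K -> \bar int) (n : \bar int) : nat :=
  match n with
  | n%:E => dimension (degree_le deg n)
  | _ => 0%N
  end.

End Degree.

(* Main.v *)
Require Import Defs.
From mathcomp Require Import all_boot all_order all_algebra.
From mathcomp Require Import fraction.
From mathcomp Require Import ring.
From mathcomp Require Import boolp classical_sets constructive_ereal.

(** An algebraic solution [f] is sent to its logarithmic derivatives
    [u_i = D_i f / f], which are elements of [A].  This turns products into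
    sums, and its kernel consists of the first integrals, because the [D_i]
    span the foliation.  So [Pi] embeds, as an F_p-vector space, into [A^n].
    Moreover [deg u_i <= deg D_i], so the image lies in a k-vector space of
    dimension the sum of the [l (deg D_i)].

    The point is therefore that elements of [Pi] independent over F_p have
    images independent over [k] ([Fp_free_frobenius_stable]).  This rests on a
    formula of Hochschild and Jacobson ([iter_p_log_derivative]): in
    characteristic [p],
      [D^p f / f = D^(p-1) u + u^p]  where  [u = D f / f].
    Since the foliation is closed under p-th powers, [D_i^p] is an
    A-combination of the [D_l], so that
      [u_i^p = \sum_l g_l u_l - D_i^(p-1) u_i]    ([log_derivative_pow]).
    The right-hand side is k-linear in [u], so each k-linear relation
    between the vectors [u] of several solutions is also a relation between
    their p-th powers.  Take a relation with the fewest nonzero coefficients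
    [c_j], one of them equal to 1.  The vectors [w_j] of the solutions satisfy
    [\sum_j c_j w_j^p = (\sum_j c_j^(1/p) w_j)^p], so the [c_j^(1/p)] are also
    the coefficients of a relation; the difference of the two relations is
    shorter, hence trivial.  So [c_j^p = c_j], all coefficients lie in F_p, and
    the relation is one over F_p. *)

Import Order.TTheory GRing.Theory Num.Theory.
Local Open Scope ring_scope.
Local Open Scope classical_set_scope.

Set Implicit Arguments.
Unset Strict Implicit.
Unset Printing Implicit Defensive.

(** * The p-th power of a derivation and logarithmic derivatives *)

Lemma leibniz_ring1 (R : pzRingType) (D : R -> R) : leibniz D -> D 1 = 0.
Proof.
by move=> DM; apply: (addrI (D 1)); rewrite -{3}(mulr1 1) DM mulr1 mul1r addr0.
Qed.

Section TwistedDerivation.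
Variables (R : comNzRingType) (D : {additive R -> R}).
Hypothesis DM : leibniz D.

(** If [D f = u * f], this is the operator [D] conjugated by multiplication by
    [f]; it makes sense for every [u], even one that is not a logarithmic
    derivative.  Its iterates at 1 are the complete Bell polynomials in [u] and
    its successive derivatives. *)
Definition twist (u x : R) : R := u * x + D x.

Lemma iter_twist_conj u x n : D x = u * x ->
  iter n D x = x * iter n (twist u) 1.
Proof.
move=> Dx; elim: n => [|n IHn]; first by rewrite mulr1.
by rewrite !iterS IHn DM Dx /twist mulrDr [u * x]mulrC -mulrA.
Qed.

(** Writing formally [u = D g], the n-th iterate is [exp(-g) D^n (exp g)];
    applying [d] to it gives the Leibniz expansion of
    [exp(-g) D^n (d g * exp g)] without the term where [d g] is not
    differentiated.  For [n] prime, all binomial coefficients but the last vanish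
    modulo [n]. *)
Lemma derivation_iter_twist (d : {additive R -> R}) u n :
    leibniz d -> (forall x, d (D x) = D (d x)) ->
  d (iter n (twist u) 1) =
    \sum_(i < n) (iter i D (d u) * iter (n - i.+1) (twist u) 1) *+ 'C(n, i.+1).
Proof.
move=> dM dD; elim: n => [|n IHn]; first by rewrite big_ord0 /= (leibniz_ring1 dM).
set v := d u in IHn *; set b := fun m => iter m (twist u) 1 in IHn *.
have step (i : 'I_n) : u * (iter i D v * b (n - i.+1)%N)
    + D (iter i D v * b (n - i.+1)%N) =
    iter i D v * b (n - i)%N + iter i.+1 D v * b (n - i.+1)%N.
  by rewrite -(subnSK (ltn_ord i)) /b iterS /twist DM iterS; ring.
rewrite iterS {1}/twist raddfD dM dD /= -/v -/(b n) IHn.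
rewrite -addrA mulr_sumr raddf_sum -big_split /=.
under eq_bigr => i _ do rewrite mulrnAr raddfMn -mulrnDl step mulrnDl.
rewrite big_split /=.
under [RHS]eq_bigr => i _ do rewrite subSS binS mulrnDr.
rewrite [RHS]big_split /= addrCA; congr (_ + _).
  by rewrite [RHS]big_ord_recr /= bin_small // mulr0n addr0.
by rewrite [RHS]big_ord_recl /= subn0 bin0 mulr1n.
Qed.

End TwistedDerivation.

Section Hochschild.
Variables (R : idomainType) (D : {additive R -> R}).
Hypothesis DM : leibniz D.

Lemma map_poly_leibniz : leibniz (map_poly D : {poly R} -> {poly R}).
Proof.
move=> f g; apply/polyP => i; rewrite coefD !coef_map /= !coefM raddf_sum.
by rewrite -big_split /=; apply: eq_bigr => j _; rewrite !coef_map DM.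
Qed.

(* The twist by [t u] in [R[t]], where [D] acts on coefficients: [u] is deformed
   so that the derivation [d/dt], which commutes with [D], can be used. *)
Local Notation P u := (fun n => iter n (twist (map_poly D) (u *: 'X)) 1).

Lemma coef_twist_recl u n i :
  (P u n.+1)`_i = (if i == 0%N then 0 else u * (P u n)`_i.-1) + D (P u n)`_i.
Proof.
rewrite /= coefD coef_map /= -scalerAl coefZ coefXM.
by case: eqP; rewrite ?mulr0.
Qed.

Lemma coef_twist_gt u n i : (n < i)%N -> (P u n)`_i = 0.
Proof.
elim: n i => [|n IHn] [|i] // ni; first by rewrite coef1.
by rewrite coef_twist_recl /= !IHn ?mulr0 ?raddf0 ?addr0 // ltnW.
Qed.

Lemma coef_twist_lead u n : (P u n)`_n = u ^+ n.
Proof.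
elim: n => [|n IHn]; first by rewrite coef1.
rewrite coef_twist_recl [X in _ + D X]coef_twist_gt // raddf0 addr0.
by rewrite IHn exprS.
Qed.

Lemma coef_twist0 u n : (P u n.+1)`_0 = 0.
Proof.
elim: n => [|n IHn]; rewrite coef_twist_recl /= add0r.
  by rewrite coef1 (leibniz_ring1 DM).
by rewrite IHn raddf0.
Qed.

Lemma horner1_twist u n : (P u n).[1] = iter n (twist D u) 1.
Proof.
have hD (q : {poly R}) : (map_poly D q).[1] = D q.[1].
  rewrite (@horner_coef_wide _ (size q)) ?size_poly // horner_coef raddf_sum.
  by apply: eq_bigr => i _; rewrite coef_map expr1n !mulr1.
elim: n => [|n IHn]; first by rewrite hornerE.
by rewrite /= hornerD hD -scalerAl hornerZ hornerM hornerX mul1r IHn.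
Qed.

(** The polynomial [P u p] has degree at most [p], no constant term and leading
    coefficient [u^p], and its derivative in [t] is the constant
    [D^(p-1) u].  As [1, ..., p-1] are invertible, this determines it:
    [P u p = t D^(p-1) u + t^p u^p].  Now put [t = 1]. *)
Lemma hochschild p u : p \in [pchar R] ->
  iter p (twist D u) 1 = iter p.-1 D u + u ^+ p.
Proof.
move=> hp; have p_pr := pcharf_prime hp; have p_gt1 := prime_gt1 p_pr.
have dP : (P u p)^`() = (iter p.-1 D u)%:P.
  have dXD (q : {poly R}) : (map_poly D q)^`() = map_poly D q^`().
    by apply/polyP => i; rewrite coef_deriv !coef_map /= coef_deriv raddfMn.
  have := @derivation_iter_twist _ _ map_poly_leibniz (@deriv R) (u *: 'X) p.
  move=> -> //; last exact: derivM.
  have it i : iter i (map_poly D) (u *: 'X)^`() = (iter i D u)%:P.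
    elim: i => [|i IHi] /=; first by rewrite derivZ derivX alg_polyC.
    by rewrite IHi map_polyC.
  case: (p) p_pr hp p_gt1 => // q q_pr hq _.
  rewrite big_ord_recr /= big1 ?add0r => [|i _]; last first.
    rewrite -mulr_natl -polyC_natr (_ : _%:R = 0) ?polyC0 ?mul0r //; apply/eqP.
    by rewrite -(dvdn_pcharf hq) prime_dvd_bin // !ltnS ltn_ord.
  by rewrite subnn binn mulr1n mulr1 it.
have Pi_eq0 i : (1 < i < p)%N -> (P u p)`_i = 0.
  case: i => [|[|i]] //= ip; have /(congr1 (fun q : {poly R} => q`_i.+1)) := dP.
  rewrite coef_deriv coefC /= -mulr_natl => /eqP.
  rewrite mulf_eq0 -(dvdn_pcharf hp) => /orP[/(dvdn_leq (ltn0Sn _))|/eqP //].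
  by rewrite leqNgt ip.
have P1 : (P u p)`_1 = iter p.-1 D u.
  by have := congr1 (fun q : {poly R} => q`_0) dP; rewrite coef_deriv coefC.
rewrite -horner1_twist (@horner_coef_wide _ p.+1); last first.
  by apply/leq_sizeP => j; apply: coef_twist_gt.
under eq_bigr => i _ do rewrite expr1n mulr1.
rewrite big_ord_recr /= coef_twist_lead; congr (_ + _).
case: (p) p_gt1 P1 Pi_eq0 => [|[|q]] // _ P1 Pi0.
rewrite big_ord_recl coef_twist0 add0r big_ord_recl P1 big1 ?addr0 // => i _.
by apply: Pi0; rewrite /= /bump /= !add1n !ltnS.
Qed.

Lemma iter_p_log_derivative p x u : p \in [pchar R] -> D x = u * x ->
  iter p D x = x * (iter p.-1 D u + u ^+ p).
Proof. by move=> hp Dx; rewrite (iter_twist_conj DM _ Dx) hochschild. Qed.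

End Hochschild.

(** * Free families and dimensions *)

Section LinearAlgebra.

Definition free_family (K : fieldType) (V : lmodType K) m (b : 'I_m -> V) :=
  forall c : 'I_m -> K, \sum_(i < m) c i *: b i = 0 -> forall i, c i = 0.

(** A free family of maximal length is a basis. *)
Lemma findim_bounded_free (K : fieldType) (V : lmodType K) N :
    (forall m (b : 'I_m -> V), free_family b -> (m <= N)%N) ->
  findim [set: V] /\ (dimension [set: V] <= N)%N.
Proof.
move=> bnd; suff fin : findim [set: V].
  split=> //; have [b [b_free _]] : has_dim [set: V] (dimension [set: V]).
    exact: xgetPex fin.
  exact: bnd b_free.
pose P m := `[< exists b : 'I_m -> V, free_family b >].
have P0 : exists m, P m.
  by exists 0%N; apply/asboolP; exists (fun=> 0) => c _ [].
have PN m : P m -> (m <= N)%N by move=> /asboolP[b]; apply: bnd.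
case: (ex_maxnP P0 PN) => m /asboolP[b b_free] m_max.
exists m, b; split=> //; apply/seteqP; split=> // x _; apply: contrapT => x_out.
suff /m_max : P m.+1 by rewrite ltnn.
(* A vector [x] outside the span would extend the maximal free family [b]. *)
apply/asboolP; exists (fun i => if unlift ord0 i is Some j then b j else x).
move=> c; rewrite big_ord_recl unlift_none.
under eq_bigr => i _ do rewrite liftK.
move=> c_rel; suff c0 : c ord0 = 0.
  move: c_rel; rewrite c0 scale0r add0r => /b_free b0 i.
  by case: (unliftP ord0 i) => [j ->|->]; [exact: b0 | exact: c0].
apply: contrapT => /eqP c0; apply: x_out.
exists (fun j => - ((c ord0)^-1 * c (lift ord0 j))) => //.
under eq_bigr => j _ do rewrite scaleNr -scalerA.
rewrite sumrN -scaler_sumr.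
have -> : \sum_j c (lift ord0 j) *: b j = - (c ord0 *: x).
  by apply/eqP; rewrite -addr_eq0 addrC c_rel.
by rewrite scalerN opprK scalerA mulVf // scale1r.
Qed.

(** The coordinates of independent vectors of [V^n] form a row-free matrix, here
    with one column for each generator [b i l] of one of the [n] factors.  The
    [b i l] need not be independent, so the coordinates are merely chosen. *)
Lemma leq_free_family_sum (K : fieldType) (V : lmodType K) m n
    (d : 'I_n -> nat) (b : forall i, 'I_(d i) -> V) (w : 'I_m -> 'I_n -> V) :
    (forall j i, exists c : 'I_(d i) -> K, w j i = \sum_l c l *: b i l) ->
    (forall c : 'I_m -> K,
       (forall i, \sum_j c j *: w j i = 0) -> forall j, c j = 0) ->
  (m <= \sum_i d i)%N.
Proof.
move=> w_span w_free.
have {w_span}[C wC] : {C : forall (j : 'I_m) (i : 'I_n), 'I_(d i) -> K |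
    forall j i, w j i = \sum_l C j i l *: b i l}.
  by exists (fun j i => sval (cid (w_span j i))) => j i; case: cid.
pose J := {i : 'I_n & 'I_(d i)}.
pose M := \matrix_(j < m, t < #|{: J}|)
  C j (tag (enum_val t)) (tagged (enum_val t)).
have cardJ : #|{: J}| = (\sum_i d i)%N.
  rewrite card_tagged sumnE big_map -big_enum /=.
  by apply: eq_bigr => i _; rewrite card_ord.
rewrite -cardJ; have /eqP <- : row_free M; last exact: rank_leq_col.
apply: inj_row_free => v vM; apply/rowP => j; rewrite mxE.
apply: (w_free (v 0)) => i {j}.
under eq_bigr => j _ do rewrite wC scaler_sumr.
rewrite exchange_big big1 //= => l _.
under eq_bigr => j _ do rewrite scalerA.
rewrite -scaler_suml; have /rowP/(_ (enum_rank (Tagged _ l : J))) := vM.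
rewrite !mxE; under eq_bigr => j _ do rewrite mxE enum_rankK /=.
by move=> ->; rewrite scale0r.
Qed.

(** The prime field already provides [p] roots of ['X^p - 'X]. *)
Lemma pchar_fixed (F : idomainType) p (c : F) : p \in [pchar F] ->
  c ^+ p = c -> exists2 e : nat, (e < p)%N & c = e%:R.
Proof.
move=> hp cp; apply: contrapT => c_out.
pose q : {poly F} := 'X^p - 'X.
have p_gt1 : (1 < p)%N := prime_gt1 (pcharf_prime hp).
have sq : size q = p.+1.
  by rewrite size_polyDl ?size_polyXn // size_polyN size_polyX ltnS.
pose rs := [seq e%:R | e <- iota 0 p] : seq F.
have rq : all (root q) (c :: rs).
  rewrite /= rootE !hornerE cp subrr eqxx /=; apply/allP => _ /mapP[e _ ->].
  by rewrite rootE !hornerE -(pFrobenius_autE hp) pFrobenius_aut_nat subrr.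
suff urs : uniq (c :: rs).
  have q0 : q != 0 by rewrite -size_poly_gt0 sq.
  by have := max_poly_roots q0 rq urs; rewrite sq /= size_map size_iota ltnn.
rewrite /=; apply/andP; split.
  apply/mapP => -[e]; rewrite mem_iota /= add0n => ep ce.
  by apply: c_out; exists e.
rewrite map_inj_in_uniq ?iota_uniq // => i j; rewrite !mem_iota !add0n /=.
wlog ij : i j / (i <= j)%N => [H|].
  by case/orP: (leq_total i j) => ij ip jp e; [|symmetry]; apply: H.
move=> ip jp /esym/eqP; rewrite -subr_eq0 -natrB // -(dvdn_pcharf hp).
case: (posnP (j - i)) => [/eqP|ji0 /(dvdn_leq ji0)].
  by rewrite subn_eq0 => ji _; apply/eqP; rewrite eqn_leq ij.
by rewrite leqNgt (leq_ltn_trans (leq_subr _ _) jp).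
Qed.

Lemma closed_field_root (k : closedFieldType) n (a : k) : (0 < n)%N ->
  exists x, x ^+ n = a.
Proof.
move=> n0; have [x xn] := solve_monicpoly (fun i => a *+ (i == 0%N)) n0.
exists x; rewrite {}xn; case: n n0 => // n _.
by rewrite big_ord_recl /= mulr1 big1 ?addr0 // => i _; rewrite mul0r.
Qed.

(** The shortest-relation argument, as in Artin's proof of the independence of
    characters, with the inverse of Frobenius in the role of the automorphism:
    a family whose k-linear relations pass to p-th powers is independent over
    [k] as soon as it is over F_p. *)
Lemma Fp_free_frobenius_stable (k : closedFieldType) p (hp : p \in [pchar k])
    (A : idomAlgType k) m n (w : 'I_m -> 'I_n -> A) :
    (forall c : 'I_m -> k, (forall i, \sum_j c j *: w j i = 0) ->
       forall i, \sum_j c j *: w j i ^+ p = 0) ->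
    (forall e : 'I_m -> 'F_p, (forall i, \sum_j w j i *+ e j = 0) ->
       forall j, e j = 0) ->
  forall c : 'I_m -> k, (forall i, \sum_j c j *: w j i = 0) ->
    forall j, c j = 0.
Proof.
move=> w_frob w_free c; have p_pr := pcharf_prime hp.
have hpA : p \in [pchar A] := pchar_idomAlg hp A.
have [N] := ubnP #|[pred j | c j != 0]|; elim: N c => // N IHN c cN c_rel j.
apply/eqP/contraT => cj.
wlog cj1 : c cN c_rel cj / c j = 1.
  move=> H; apply: (H (fun l => (c j)^-1 * c l)) => [|i||]; last exact: mulVf.
  - rewrite (eq_card (B := [pred l | c l != 0])) // => l.
    by rewrite !inE mulf_eq0 invr_eq0 (negPf cj).
  - under eq_bigr => l _ do rewrite -scalerA.
    by rewrite -scaler_sumr c_rel scaler0.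
  - by rewrite mulVf // oner_neq0.
have [r rP] : {r : 'I_m -> k | forall l, r l ^+ p = c l}.
  exists (fun l => sval (cid (closed_field_root (c l) (prime_gt0 p_pr)))) => l.
  by case: cid.
have r_rel i : \sum_l r l *: w l i = 0.
  apply/eqP; have := w_frob _ c_rel i.
  under eq_bigr => l _ do rewrite -rP -exprZn -(pFrobenius_autE hpA).
  rewrite -rmorph_sum /= pFrobenius_autE => /eqP.
  by rewrite expf_eq0 => /andP[].
(* [c - r] vanishes wherever [c] does, and also at [j]. *)
have cr l : c l = r l.
  apply/eqP; rewrite -subr_eq0; apply/eqP.
  apply: (IHN (fun l => c l - r l)) => [|i]; last first.
    under eq_bigr => l' _ do rewrite scalerBl.
    by rewrite sumrB c_rel r_rel subrr.
  rewrite -ltnS; apply: leq_trans cN; apply: proper_card; apply/properP; split.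
    apply/fintype.subsetP => l'; rewrite !inE; apply: contraNneq => c0.
    have /eqP := rP l'; rewrite c0 expf_eq0 => /andP[_ /eqP ->].
    by rewrite subr0.
  exists j; rewrite !inE // negbK cj1 subr_eq0 eq_sym; apply/eqP.
  apply: (fmorph_inj (pFrobenius_aut hp)).
  by rewrite /= !pFrobenius_autE rP cj1 expr1n.
have [e eP] : {e : 'I_m -> nat | forall l, c l = (e l)%:R}.
  have ce l : exists e, c l = e%:R.
    by have [|e _] := @pchar_fixed _ _ (c l) hp; [rewrite {1}cr|exists e].
  by exists (fun l => sval (cid (ce l))) => l; case: cid.
have e_rel i : \sum_l w l i *+ ((e l)%:R : 'F_p) = 0.
  rewrite -[RHS](c_rel i); apply: eq_bigr => l _.
  rewrite eP scaler_nat (val_Fp_nat p_pr) -mulr_natl.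
  by rewrite (GRing.natr_mod_pchar hpA) mulr_natl.
have /(congr1 val) := w_free (fun l => (e l)%:R) e_rel j.
rewrite /= (val_Fp_nat p_pr) => ej; move/eqP: cj1.
by rewrite eP -(GRing.natr_mod_pchar hp) ej eq_sym oner_eq0.
Qed.
End LinearAlgebra.

(** * Degrees of logarithmic derivatives *)

Section Degree.

(** The supremum is a chosen least upper bound, with a default value when there
    is none; so one has to be exhibited.  A set that contains an integer and is
    bounded by one has a greatest element; in the other cases the least upper
    bound is infinite. *)
Lemma ereal_int_supremum (S : set (\bar int)) (x : \bar int) :
  S x -> (x <= supremum -oo S)%E.
Proof.
move=> Sx; apply: ge_supremum_Nmem => //.
have [[u Su]|no_ub] := pselect (exists u : int, ubound S u%:E); last first.
  exists +oo%E; split=> [y _|b Sb]; first exact: leey.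
  case: b Sb => [u Su|//|SNy]; first by case: no_ub; exists u.
  case: no_ub; exists 0 => y /SNy; rewrite leeNy_eq => /eqP ->.
  exact: leNye.
have [[r Sr]|no_int] := pselect (exists r : int, S r%:E); last first.
  exists -oo%E; split=> [y Sy|b _]; last exact: leNye.
  case: y Sy => [r Sr|/Su|//]; first by case: no_int; exists r.
  by rewrite leye_eq.
have Sgap r' : S r'%:E -> r' = u - `|u - r'|%N%:Z.
  by move=> /Su; rewrite lee_fin => ru; rewrite gez0_abs ?subr_ge0 // subKr.
pose P j := `[< S (u - j%:Z)%:E >].
have exP : exists j, P j by exists `|u - r|%N; apply/asboolP; rewrite -Sgap.
case: (ex_minnP exP) => j /asboolP Sj j_min.
exists (u - j%:Z)%:E; split=> [y Sy|b]; last exact.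
case: y Sy => [s Ss|/Su|_]; [|by rewrite leye_eq|exact: leNye].
rewrite lee_fin (Sgap s Ss) lerD2l lerN2 lez_nat j_min //.
by apply/asboolP; rewrite -Sgap.
Qed.

Variables (k : fieldType) (A : idomAlgType k).
Local Notation K := {fraction A}.

Lemma degree_log_derivative (deg : K -> \bar int) (D : derivation A) (f : K) :
    degree_function deg -> f != 0 ->
  (deg (der_frac D f / f)%R <= der_degree deg D)%E.
Proof.
move=> degP f0.
suff -> : deg (der_frac D f / f) = (deg (der_frac D f) - deg f)%E.
  by apply: ereal_int_supremum; exists f.
have : deg (der_frac D f) = (deg (der_frac D f / f)%R + deg f)%E.
  by rewrite -(degreeM degP) divfK.
move=> ->.
case: (deg f) (degree_lty degP f) (degree_eqNy degP f) => [r _ _|//|_].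
  by rewrite addeK.
by case=> /(_ erefl)/eqP; rewrite (negPf f0).
Qed.

Lemma log_derivative_basis (deg : K -> \bar int) (D : derivation A) :
    good_degree deg ->
  exists b : 'I_(ldim deg (der_degree deg D)) -> A,
    forall (f : K) (u : A), f != 0 -> der_frac D f / f = u%:F ->
      exists c, u = \sum_l c l *: b l.
Proof.
move=> [degP _ D_fin fin].
have Du f u : f != 0 -> der_frac D f / f = u%:F ->
    (deg u%:F <= der_degree deg D)%E.
  by move=> f0 <-; apply: degree_log_derivative.
move: (D_fin D) Du; case: der_degree => [r _|//|_] Du.
  have [b [_ bE]] : has_dim (degree_le deg r) (dimension (degree_le deg r)).
    exact: xgetPex (fin r).
  exists b => f u f0 /(Du f u f0) ur.
  have : degree_le deg r u by [].
  by rewrite bE => -[c _ <-]; exists c.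
exists (fun=> 0) => f u f0 /(Du f u f0); rewrite leeNy_eq => /eqP.
move=> /(degree_eqNy degP)/eqP; rewrite tofrac_eq0 => /eqP ->.
by exists (fun=> 0); rewrite big_ord0.
Qed.

End Degree.

(** * Logarithmic derivatives of algebraic solutions *)

Section LogDerivative.
Variables (k : fieldType) (p : nat) (hp : p \in [pchar k]) (A : idomAlgType k).
Local Notation K := {fraction A}.
Implicit Types (D : derivation A) (f : K).

(** Every derivation kills p-th powers, so a fraction with such a denominator is
    differentiated through its numerator alone.  This reduces statements about
    [der_frac] to computations in [A]. *)
Lemma frac_pth_denominator f : exists2 xy : A * A,
  xy.2 != 0 & f = xy.1%:F / xy.2%:F ^+ p.
Proof.
have p_gt0 := prime_gt0 (pcharf_prime hp).
have [[x y] /= y0 ->] := fracP f; exists (x * y ^+ p.-1, y) => //=.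
have yF0 : y%:F != 0 :> K by rewrite tofrac_eq0.
rewrite tofracM tofracXn -{2}(prednK p_gt0) exprSr invfM.
by rewrite mulrA mulfK ?expf_neq0.
Qed.

Lemma der_frac_pth_denominator D (x y : A) : y != 0 ->
  der_frac D (x%:F / y%:F ^+ p) = (D x)%:F / y%:F ^+ p.
Proof.
move=> y0; have yF0 : y%:F != 0 :> K by rewrite tofrac_eq0.
have [_ /(_ D I) Dy] :=
  first_integralV (first_integral_pchar [set: derivation A] hp yF0).
by rewrite der_fracM Dy mulr0 addr0 der_frac_tofrac.
Qed.

Lemma log_derivative_numerator D (x y u : A) : x != 0 -> y != 0 ->
  der_frac D (x%:F / y%:F ^+ p) / (x%:F / y%:F ^+ p) = u%:F -> D x = u * x.
Proof.
move=> x0 y0; have xF0 : x%:F != 0 :> K by rewrite tofrac_eq0.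
have yF0 : y%:F ^+ p != 0 :> K by rewrite expf_neq0 // tofrac_eq0.
rewrite der_frac_pth_denominator // -mulf_div divff ?invr_neq0 // mulr1.
move=> /(canRL (divfK xF0)) /eqP; rewrite -tofracM tofrac_eq => /eqP //.
Qed.

Lemma der_sumE n (a : 'I_n -> A) (D : 'I_n -> derivation A) x :
  (\sum_(i < n) a i *: D i) x = \sum_(i < n) a i * D i x.
Proof. exact: (big_morph (fun E : derivation A => E x)). Qed.

Lemma der_frac_sum n (a : 'I_n -> A) (D : 'I_n -> derivation A) f :
  der_frac (\sum_(i < n) a i *: D i) f =
    \sum_(i < n) (a i)%:F * der_frac (D i) f.
Proof.
symmetry; move: f; apply: der_frac_unique => [f g|x]; last first.
  rewrite der_sumE raddf_sum; apply: eq_bigr => i _.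
  by rewrite /= der_frac_tofrac tofracM.
rewrite mulr_suml mulr_sumr -big_split; apply: eq_bigr => i _ /=.
by rewrite der_fracM mulrDr mulrA [_ * (f * _)]mulrCA.
Qed.

(** Hochschild's formula compared with the expression of [D_i^p] in the [D_l].
    What matters is that the right-hand side is k-linear in [u]. *)
Lemma log_derivative_pow n (D : 'I_n -> derivation A) (i : 'I_n)
    (g u : 'I_n -> A) f :
    f != 0 -> derpow hp (D i) = \sum_(l < n) g l *: D l ->
    (forall l, der_frac (D l) f / f = (u l)%:F) ->
  u i ^+ p = \sum_(l < n) g l * u l - iter p.-1 (D i) (u i).
Proof.
have [[x y] /= y0 ->] := frac_pth_denominator f => xy0 Dip fu.
have x0 : x != 0.
  by apply: contraNneq xy0 => ->; rewrite tofrac0 mul0r.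
have xu l : D l x = u l * x by exact: log_derivative_numerator (fu l).
have hpA : p \in [pchar A] := pchar_idomAlg hp A.
apply/eqP; rewrite eq_sym subr_eq addrC; apply/eqP; apply: (mulfI x0).
rewrite -(iter_p_log_derivative (@derM _ _ (D i)) hpA (xu i)).
have <- : derpow hp (D i) x = iter p (D i) x by [].
rewrite Dip der_sumE mulr_sumr; apply: eq_bigr => l _.
by rewrite xu mulrCA [x * u l]mulrC.
Qed.

End LogDerivative.

(** * The embedding of [Pi] by logarithmic derivatives *)

Section LogDerivativePi.
Variables (k : fieldType) (p : nat) (hp : p \in [pchar k]) (A : idomAlgType k).
Variable DD : set (derivation A).
Local Notation K := {fraction A}.
Local Notation Pi := (Pi DD hp).
Local Open Scope quotient_scope.

(** Read off the chosen representative of the class; [log_der_pi] shows that,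
    for [D] in [DD], every other one gives the same value. *)
Definition log_der (D : derivation A) (x : Pi) : A :=
  xget 0 [set u : A | der_frac D (val (repr x)) / val (repr x) = u%:F].

Lemma log_der_pi D (s : solution DD) : DD D ->
  der_frac D s / (s : K) = (log_der D (\pi_Pi s))%:F.
Proof.
move=> DDD; set t := repr (\pi_Pi s).
have /eqP/Pi_eqP[st0 /(_ D DDD) st] : \pi_Pi s = \pi_Pi t by rewrite reprK.
have [_ /(_ D DDD) t_sol] := elimT (asboolP _) (solutionP t).
rewrite -(xgetPex 0 t_sol) -/t.
have {1 2}-> : (s : K) = (s : K) / (t : K) * (t : K).
  by rewrite divfK // solution_neq0.
by rewrite (leibniz_logM (der_fracM D)) ?solution_neq0 // st mul0r add0r.
Qed.

Lemma log_der0 D : DD D -> log_der D 0 = 0.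
Proof.
move=> DDD; apply/eqP; rewrite -tofrac_eq0 -(log_der_pi (sol1 DD)) //=.
by rewrite (leibniz1 (der_fracM D)) mul0r.
Qed.

Lemma log_derD D : DD D -> {morph log_der D : x y / x + y}.
Proof.
move=> DDD; elim/quotW=> s; elim/quotW=> t.
rewrite -[\pi_Pi s + _](pi_solM hp s t); apply/eqP; rewrite -tofrac_eq tofracD.
rewrite -!log_der_pi //= (leibniz_logM (der_fracM D)) ?solution_neq0 //.
Qed.

Lemma log_der_sum D m (e : 'I_m -> 'F_p) (b : 'I_m -> Pi) : DD D ->
  log_der D (\sum_j e j *: b j) = \sum_j log_der D (b j) *+ e j.
Proof.
move=> DDD; rewrite (big_morph _ (log_derD DDD) (log_der0 DDD)).
apply: eq_bigr => j _; rewrite -[_ *: _]/(b j *+ e j).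
elim: (e j : nat) => [|l IHl]; first exact: log_der0.
by rewrite !mulrS log_derD // IHl.
Qed.

Lemma log_der_inj (x : Pi) : (forall D, DD D -> log_der D x = 0) -> x = 0.
Proof.
elim/quotW: x => s s0; apply/eqP/Pi_eqP; rewrite /= divr1.
split=> [|D DDD]; first exact: solution_neq0.
have /eqP := log_der_pi s DDD; rewrite s0 // tofrac0 mulf_eq0 invr_eq0.
by rewrite (negPf (solution_neq0 s)) orbF => /eqP.
Qed.

End LogDerivativePi.

Theorem corollary1p5 (k : closedFieldType) (p : nat) (hp : p \in [pchar k])
  (A : idomAlgType k) (A_fin : finite_type A)
  (deg : {fraction A} -> \bar int) (deg_good : good_degree deg)
  (F : set (derivation A)) (F_fol : foliation hp F)
  (n : nat) (D : 'I_n -> derivation A)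
  (F_span : F = [set \sum_(i < n) a i *: D i | a in [set: 'I_n -> A]]) :
  findim [set: Pi F hp] /\
  (dimension [set: Pi F hp] <= \sum_(i < n) ldim deg (der_degree deg (D i)))%N.
Proof.
apply: findim_bounded_free => m b b_free.
have FD i : F (D i).
  rewrite F_span; exists (fun l => (l == i)%:R) => //.
  rewrite (bigD1 i) //= eqxx scale1r big1 ?addr0 // => l /negPf ->.
  by rewrite scale0r.
have FE E : F E -> exists g : 'I_n -> A, E = \sum_l g l *: D l.
  by rewrite F_span => -[g _ <-]; exists g.
pose f j : {fraction A} := val (repr (b j)).
have f0 j : f j != 0 := solution_neq0 _.
pose w j i := log_der (D i) (b j).
have fw j i : der_frac (D i) (f j) / f j = (w j i)%:F.
  by rewrite /f (log_der_pi hp _ (FD i)) reprK.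
pose B i := projT1 (cid (log_derivative_basis (D i) deg_good)).
have BP i : forall g u, g != 0 -> der_frac (D i) g / g = u%:F ->
    exists c, u = \sum_l c l *: B i l.
  by rewrite /B; case: cid.
apply: (@leq_free_family_sum k A m n _ B w) => [j i|].
  exact: BP (f0 j) (fw j i).
apply: (Fp_free_frobenius_stable hp) => [c c_rel i|e e_rel j].
  (* A relation between the [w j i] passes to their p-th powers. *)
  have [g gE] := FE _ (foliation_pow F_fol (FD i)).
  under eq_bigr => j _ do
    rewrite (log_derivative_pow (f0 j) gE (fw j)) scalerBr scaler_sumr.
  rewrite sumrB exchange_big big1 /= => [|l _].
    rewrite sub0r; apply/eqP; rewrite oppr_eq0; apply/eqP.
    elim: p.-1 => [|q IHq] /=; first exact: c_rel.
    under eq_bigr => j _ do rewrite -linearZ.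
    by rewrite -linear_sum IHq linear0.
  under eq_bigr => j _ do rewrite scalerAr.
  by rewrite -mulr_sumr c_rel mulr0.
(* A relation over F_p between the [w j i] is one between the [b j]. *)
apply: (b_free e _ j); apply: log_der_inj => E FE'.
have [g Eg] := FE _ FE'.
set x := \sum_l _; apply/eqP; rewrite -tofrac_eq0 -[x]reprK -log_der_pi //.
rewrite Eg der_frac_sum mulr_suml big1 // => l _.
rewrite -mulrA (log_der_pi hp _ (FD l)) reprK log_der_sum //.
by rewrite e_rel mulr0.
Qed.
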